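(* Let $G$ be a finitely generated group with trivial centre, let $\Psi:\mathrm{Aut}(G)\to\mathrm{Out}(G)$ be the quotient map, and let $H<\mathrm{Out}(G)$ be a subgroup. Let $\Gamma_H=\Psi^{-1}(H)$ and let $\phi\in\mathrm{Aut}(G)$. Suppose that: (1) there exists $x\in G$ such that $\phi(x)\neq h(x)$ for all $h\in\Gamma_H$; and (2) $\Gamma_H$ is conjugacy separable. Then there exist a finite group $F$ and a homomorphism $q:\mathrm{Out}(G)\to F$ with $q(\Psi(\phi))\notin q(H)$.
   Context: $\mathrm{Out}(G)=\mathrm{Aut}(G)/\mathrm{Inn}(G)$. A group is conjugacy separable if any two non-conjugate elements have non-conjugate images in some finite quotient. *)

(* Defs.v *)
From HB Require Import structures.
From mathcomp Require Import fingroup all_boot boolp.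

Set Implicit Arguments.
Unset Strict Implicit.
Unset Printing Implicit Defensive.

Local Open Scope group_scope.
Local Open Scope quotient_scope.

(* Arbitrary (possibly infinite) groups are groupTypes; a subgroup of G is a  *)
(* groupClosed predicate on G.  Predicates are boolean, which is no           *)
(* restriction since `[< P >] turns any proposition P into a boolean.         *)

Definition finitely_generated (G : groupType) : Prop :=
  exists s : seq G, forall S : groupClosed G,
    {subset s <= S} -> forall x : G, x \in S.

Definition trivial_center (G : groupType) : Prop :=
  forall z : G, (forall x : G, commute z x) -> z = 1.

Definition conjugate (G : groupType) (x y : G) : Prop :=
  exists g : G, y = x ^ g.

(* A finite quotient is a finite group F with a surjection from G onto it. *)
Definition conjugacy_separable (G : groupType) : Prop :=
  forall x y : G, ~ conjugate x y ->
    exists (F : finGroupType) (f : {multiplicative G -> F}),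
      (forall u : F, exists g : G, f g = u) /\ ~ conjugate (f x) (f y).

(* The product of Aut is composition, (f * g) x = f (g x), and inner g is     *)
(* x |-> g x g^-1, so that inner is a homomorphism from G to Aut G.          *)
Section Aut.
Variable G : groupType.

Definition is_aut (f : G -> G) : Prop :=
  {morph f : x y / x * y} /\ bijective f.

Record Aut := MkAut { aut_fun :> G -> G; _ : `[< is_aut aut_fun >] }.

HB.instance Definition _ := [isSub for aut_fun].
HB.instance Definition _ := [Choice of Aut by <:].

Lemma autP (f : Aut) : is_aut f.
Proof. by apply/asboolP; case: f. Qed.

Lemma aut_eqP (f g : Aut) : f =1 g -> f = g.
Proof. by move=> fg; apply/val_inj/funext. Qed.

Lemma is_aut_id : is_aut id.
Proof. by split=> //; exists id. Qed.

Lemma is_aut_comp (f g : Aut) : is_aut (f \o g).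
Proof.
have [fM fB] := autP f; have [gM gB] := autP g; split; last exact: bij_comp.
by move=> x y; rewrite /= gM fM.
Qed.

Lemma aut_inv_ex (f : Aut) :
  exists g : G -> G, [/\ is_aut g, cancel f g & cancel g f].
Proof.
have [fM [g fK gK]] := autP f; exists g; split=> //; split; last by exists f.
by move=> x y; apply: (can_inj fK); rewrite fM !gK.
Qed.

Definition aut_inv_fun (f : Aut) : G -> G := projT1 (cid (aut_inv_ex f)).

Lemma aut_inv_funP (f : Aut) :
  [/\ is_aut (aut_inv_fun f), cancel f (aut_inv_fun f)
    & cancel (aut_inv_fun f) f].
Proof. exact: projT2 (cid (aut_inv_ex f)). Qed.

Lemma is_aut_inv (f : Aut) : is_aut (aut_inv_fun f).
Proof. by case: (aut_inv_funP f). Qed.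

Definition aut1 : Aut := MkAut (asboolT is_aut_id).
Definition aut_mul (f g : Aut) : Aut := MkAut (asboolT (is_aut_comp f g)).
Definition aut_inv (f : Aut) : Aut := MkAut (asboolT (is_aut_inv f)).

Lemma aut_mulA : associative aut_mul.
Proof. by move=> f g h; apply: aut_eqP. Qed.

Lemma aut_mul1 : left_id aut1 aut_mul.
Proof. by move=> f; apply: aut_eqP. Qed.

Lemma aut_mulr1 : right_id aut1 aut_mul.
Proof. by move=> f; apply: aut_eqP. Qed.

Lemma aut_mulV : left_inverse aut1 aut_inv aut_mul.
Proof. by move=> f; apply: aut_eqP; case: (aut_inv_funP f). Qed.

Lemma aut_mulrV : right_inverse aut1 aut_inv aut_mul.
Proof. by move=> f; apply: aut_eqP; case: (aut_inv_funP f). Qed.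

HB.instance Definition _ :=
  isGroup.Build Aut aut_mulA aut_mul1 aut_mulr1 aut_mulV aut_mulrV.

Lemma autME (f g : Aut) x : (f * g) x = f (g x).
Proof. by []. Qed.

Lemma aut1E x : (1 : Aut) x = x.
Proof. by []. Qed.

HB.instance Definition _ (f : Aut) := isMultiplicative.Build G G f (autP f).1.

Lemma is_aut_conj (g : G) : is_aut (fun x => g * x * g^-1).
Proof.
split=> [x y|]; first by rewrite !mulgA mulgVK.
exists (fun x => g^-1 * x * g) => x; rewrite !mulgA ?mulVg ?mulgV mul1g.
  by rewrite mulgVK.
by rewrite mulgK.
Qed.

Definition inner (g : G) : Aut := MkAut (asboolT (is_aut_conj g)).

Definition Inn : {pred Aut} := [pred f | `[< exists g : G, f = inner g >]].

Lemma InnP (f : Aut) : reflect (exists g : G, f = inner g) (f \in Inn).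
Proof. exact: asboolP. Qed.

Lemma innerM (g h : G) : inner (g * h) = inner g * inner h.
Proof. by apply: aut_eqP => x /=; rewrite invgM !mulgA. Qed.

HB.instance Definition _ := isMultiplicative.Build G Aut inner innerM.

Lemma inner1 : inner 1 = 1.
Proof. by apply: aut_eqP => x /=; rewrite invg1 mulg1 mul1g. Qed.

Lemma innerV (g : G) : inner g^-1 = (inner g)^-1.
Proof. by apply/esym/mulg1_eq; rewrite -innerM mulgV inner1. Qed.

Lemma innerJ (f : Aut) (g : G) : f * inner g * f^-1 = inner (f g).
Proof.
apply: aut_eqP => x /=; have [fM _] := autP f.
have [_ fK fVK] := aut_inv_funP f.
rewrite !fM fVK; congr (_ * _); apply/esym/mulg1_eq.
have f1 : f 1 = 1 by apply: (@mulgI _ (f 1)); rewrite -fM !mulg1.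
by rewrite -fM mulgV f1.
Qed.

Lemma Inn_groupP : 1 \in Inn /\ divg_closed Inn.
Proof.
split; first by apply/InnP; exists 1; rewrite inner1.
move=> _ _ /InnP[g ->] /InnP[h ->]; apply/InnP; exists (g / h).
by rewrite innerM innerV.
Qed.

HB.instance Definition _ := isMulClosed.Build Aut Inn (group_closedM Inn_groupP).
HB.instance Definition _ := isMul1Closed.Build Aut Inn Inn_groupP.1.
HB.instance Definition _ := isInvClosed.Build Aut Inn (group_closedV Inn_groupP).

Lemma Inn_conj (f u : Aut) : u \in Inn -> f * u * f^-1 \in Inn.
Proof. by move=> /InnP[g ->]; apply/InnP; exists (f g); rewrite innerJ. Qed.

Definition eq_mod_Inn (f g : Aut) : bool := f / g \in Inn.

Lemma eq_mod_Inn_equiv : equiv_class_of eq_mod_Inn.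
Proof.
split=> [f|f g|g f h]; rewrite /eq_mod_Inn.
- by rewrite mulgV gpred1.
- by rewrite gpredFC.
- by move=> fg gh; rewrite -(divgKA g); apply: gpredM.
Qed.

Canonical eq_mod_Inn_equivRel := EquivRelPack eq_mod_Inn_equiv.

Definition Out := {eq_quot eq_mod_Inn}.

HB.instance Definition _ := Choice.on Out.
HB.instance Definition _ := EqQuotient.on Out.

Definition Psi (f : Aut) : Out := \pi_Out f.

Lemma Psi_eqP (f g : Aut) : reflect (Psi f = Psi g) (f / g \in Inn).
Proof. exact: (iffP (eqmodP eq_mod_Inn_equivRel f g)). Qed.

Lemma PsiK (a : Out) : Psi (repr a) = a.
Proof. exact: reprK. Qed.

Definition out1 : Out := Psi 1.
Definition out_mul (a b : Out) : Out := Psi (repr a * repr b).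
Definition out_inv (a : Out) : Out := Psi (repr a)^-1.

Lemma Psi_mul (f g : Aut) : Psi (f * g) = out_mul (Psi f) (Psi g).
Proof.
apply/Psi_eqP; set f' := repr _; set g' := repr (Psi g).
have ff' : f / f' \in Inn by apply/Psi_eqP; rewrite PsiK.
have gg' : g / g' \in Inn by apply/Psi_eqP; rewrite PsiK.
rewrite invgM.
have -> : f * g * (g'^-1 / f') = f * (g / g') * f^-1 * (f / f').
  by rewrite !mulgA mulgVK.
by apply: gpredM => //; apply: Inn_conj.
Qed.

Lemma out_mulA : associative out_mul.
Proof.
by move=> a b c; rewrite -(PsiK a) -(PsiK b) -(PsiK c) -!Psi_mul mulgA.
Qed.

Lemma out_mul1 : left_id out1 out_mul.
Proof. by move=> a; rewrite -(PsiK a) -Psi_mul mul1g. Qed.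

Lemma out_mulr1 : right_id out1 out_mul.
Proof. by move=> a; rewrite -(PsiK a) -Psi_mul mulg1. Qed.

Lemma out_mulV : left_inverse out1 out_inv out_mul.
Proof. by move=> a; rewrite -{2}(PsiK a) -Psi_mul mulVg. Qed.

Lemma out_mulrV : right_inverse out1 out_inv out_mul.
Proof. by move=> a; rewrite -{1}(PsiK a) -Psi_mul mulgV. Qed.

HB.instance Definition _ :=
  isGroup.Build Out out_mulA out_mul1 out_mulr1 out_mulV out_mulrV.

HB.instance Definition _ := isMultiplicative.Build Aut Out Psi Psi_mul.
HB.instance Definition _ :=
  Multiplicative_isUMagmaMorphism.Build Aut Out Psi (erefl _).

Section Gamma.
Variable H : groupClosed Out.

Definition Gamma : {pred Aut} := [pred f | Psi f \in H].

Lemma Gamma_groupP : group_closed Gamma.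
Proof.
split=> [|f g]; rewrite !inE ?gmulf1 ?gpred1 // gmulfF.
exact: gpredF.
Qed.

HB.instance Definition _ :=
  isMulClosed.Build Aut Gamma (group_closedM Gamma_groupP).
HB.instance Definition _ := isMul1Closed.Build Aut Gamma Gamma_groupP.1.
HB.instance Definition _ :=
  isInvClosed.Build Aut Gamma (group_closedV Gamma_groupP).

Record Gamma_group := MkGamma { gamma_val :> Aut; _ : gamma_val \in Gamma }.

HB.instance Definition _ := [isSub for gamma_val].
HB.instance Definition _ := [Choice of Gamma_group by <:].
HB.instance Definition _ :=
  SubChoice_isSubGroup.Build Aut Gamma Gamma_group Gamma_groupP.

End Gamma.
End Aut.

(* Main.v *)
(** Let F be a finite group and f : Gamma_H -> F a homomorphism separating the
    conjugacy classes of inner x and inner (phi x), which are not conjugate in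
    Gamma_H because G is centreless.  Since G is finitely generated, Aut G acts
    by precomposition on the finite set Hom(G, F); dividing the image of
    Aut G in Sym(Hom(G, F)) by the image of Inn G gives q.  If
    q (Psi phi) = q (Psi h) with h in Gamma_H, then phi and inner g * h agree
    on the point rho := f o inner of Hom(G, F) for some g, so rho (phi x) is
    conjugate in F to rho (h x) = f (h * inner x * h^-1), hence to
    f (inner x). *)
Require Import Defs.
From HB Require Import structures.
From mathcomp Require Import fingroup perm quotient all_boot boolp.

Set Implicit Arguments.
Unset Strict Implicit.
Unset Printing Implicit Defensive.

Local Open Scope group_scope.

Section Homs.
Variables (G F : groupType).
Implicit Types u v : G -> F.

Definition is_hom u : Prop := {morph u : x y / x * y}.

Lemma is_hom_comp u (a : Aut G) : is_hom u -> is_hom (u \o a).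
Proof. by move=> uM x y; rewrite /= gmulfM uM. Qed.

Lemma hom1 u : is_hom u -> u 1 = 1.
Proof. by move=> uM; apply: (mulgI (u 1)); rewrite -uM !mulg1. Qed.

Lemma homV u x : is_hom u -> u x^-1 = (u x)^-1.
Proof. by move=> uM; apply/esym/mulg1_eq; rewrite -uM mulgV hom1. Qed.

Definition equalizer u v : {pred G} := [pred x | u x == v x].

Lemma equalizer_group_closed u v :
  is_hom u -> is_hom v -> group_closed (equalizer u v).
Proof.
move=> uM vM; split=> [|x y]; rewrite !inE ?hom1 //.
by move=> /eqP xE /eqP yE; rewrite uM vM !homV // xE yE.
Qed.

(** The equalizer of two homomorphisms is a subgroup; once it contains [s], it is all of [G]. *)
Lemma hom_eq_on_generators (s : seq G) u v :
    (forall S : groupClosed G, {subset s <= S} -> forall x : G, x \in S) ->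
  is_hom u -> is_hom v -> {in s, u =1 v} -> u = v.
Proof.
move=> sG uM vM uv; have eqG := equalizer_group_closed uM vM.
pose S : groupClosed G := HB.pack (equalizer u v)
  (isMulClosed.Build G (equalizer u v) (group_closedM eqG))
  (isMul1Closed.Build G (equalizer u v) eqG.1)
  (isInvClosed.Build G (equalizer u v) (group_closedV eqG)).
apply/funext => x; apply/eqP; apply: (sG S) => y ys.
by rewrite inE uv.
Qed.

End Homs.

Lemma finite_homs (G : groupType) (F : finGroupType) :
  finitely_generated G ->
  exists e : seq (G -> F), forall u, u \in e <-> is_hom u.
Proof.
move=> [s sG].
have trivial_hom : is_hom (fun _ : G => 1 : F) by move=> x y; rewrite mulg1.
(* A homomorphism is determined by its values [t] on the generators, and there are finitely many
   tuples [t]. Tuples that no homomorphism realises get the trivial one, so that the list contains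
   homomorphisms only. *)
have /choice[hom_of hom_ofP] (t : (size s).-tuple F) : exists u : G -> F,
    is_hom u /\ forall v, is_hom v -> map v s = t -> u = v.
  have [[u [uM us]]|nex] := pselect (exists u, is_hom u /\ map u s = t).
    exists u; split=> // v vM vs; apply: (hom_eq_on_generators sG) => //.
    by apply/eq_in_map; rewrite us vs.
  by exists (fun=> 1); split=> // v vM vs; case: nex; exists v.
exists (map hom_of (enum {: (size s).-tuple F})) => u.
split=> [/mapP[t _ ->]|uM].
  by have [] := hom_ofP t.
have [_ /(_ u uM erefl) <-] := hom_ofP (map_tuple u (in_tuple s)).
by rewrite map_f // mem_enum.
Qed.

(** Precomposition is a right action, and the product of permutations applies its left factor first;
    hence [th] preserves products instead of reversing them. *)
Lemma aut_perm_rep (G : groupType) (T : choiceType) (e : seq (G -> T)) :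
    (forall (u : G -> T) (a : Aut G), u \in e -> u \o a \in e) ->
  exists th : {multiplicative Aut G -> {perm seq_sub e}},
    forall (a : Aut G) (u : seq_sub e), val (th a u) = val u \o a.
Proof.
move=> eA.
pose act (a : Aut G) (u : seq_sub e) := SeqSub (eA (val u) a (valP u)).
have actK (a b : Aut G) : b * a = 1 -> cancel (act b) (act a).
  move=> ba u; apply/val_inj/funext => x /=.
  by rewrite -autME ba aut1E.
pose th a := perm (can_inj (actK _ _ (mulgV a))).
have thM : {morph th : a b / a * b}.
  by move=> a b; apply/perm.permP => u; rewrite permM !permE; apply/val_inj.
pose th_hom : {multiplicative Aut G -> {perm seq_sub e}} :=
  HB.pack th (isMultiplicative.Build _ _ th thM).
exists th_hom => a u /=.
by rewrite permE.
Qed.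

(** The target is ['N(I) / I] for [I] the image of the inner automorphisms: by [innerJ], the image
    of [th] normalises [I]. *)
Lemma out_hom_of_aut_hom (G : groupType) (P : finGroupType)
    (th : {multiplicative Aut G -> P}) :
  exists (F : finGroupType) (q : {multiplicative Out G -> F}),
    forall a b : Aut G, q (Psi a) = q (Psi b) ->
      exists g : G, th a = th (inner g * b).
Proof.
pose I := [set p : P | `[< exists g : G, p = th (inner g) >]].
have inI p : reflect (exists g : G, p = th (inner g)) (p \in I).
  by rewrite inE; apply: asboolP.
have th1 : th 1 = 1 := hom1 (gmulfM (s := th)).
have thV a : th a^-1 = (th a)^-1 := homV a (gmulfM (s := th)).
have I_group : group_set I.
  apply/group_setP; split=> [|_ _ /inI[g ->] /inI[h ->]].
    by apply/inI; exists 1; rewrite inner1 th1.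
  by apply/inI; exists (g * h); rewrite innerM gmulfM.
pose IG := fingroup.Group I_group.
have thN a : th a \in 'N(IG).
  (* By finiteness one inclusion suffices. Passing to the inverse turns [p ^ (th a)^-1] into the
     left conjugation of [innerJ]. *)
  rewrite -groupV; apply/normP/eqP; rewrite eqEcard cardJg leqnn andbT.
  apply/subsetP => _ /imsetP[_ /inI[g ->] ->].
  apply/inI; exists (a g).
  by rewrite -innerJ !gmulfM thV conjgE invgK mulgA.
pose q (a : Out G) := coset IG (th (repr a)).
have qPsi a : q (Psi a) = coset IG (th a).
  have /Psi_eqP/InnP[g gE] : Psi (repr (Psi a)) = Psi a by rewrite PsiK.
  apply/rcoset_kercosetP => //; apply/rcosetP; exists (th (inner g)).
    by apply/inI; exists g.
  by rewrite -gmulfM -gE mulgVK.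
have qM : {morph q : a b / a * b}.
  move=> a b; rewrite -{1}(PsiK a) -{1}(PsiK b) -gmulfM qPsi gmulfM.
  exact: coset_morphM.
pose q_hom : {multiplicative Out G -> coset_of IG} :=
  HB.pack q (isMultiplicative.Build _ _ q qM).
exists (coset_of IG), q_hom => a b /=.
rewrite !qPsi => /(rcoset_kercosetP (thN a) (thN b))/rcosetP.
by case=> [_ /inI[g ->] ->]; exists g; rewrite gmulfM.
Qed.

(** If [x] and [y] induce the same conjugation, then [x / y] is central. *)
Lemma inner_inj (G : groupType) : trivial_center G -> injective (@inner G).
Proof.
move=> ZG x y xy; apply: (mulIg y^-1); rewrite mulgV; apply: ZG => z.
have /(congr1 (fun a : Aut G => a z)) : inner (x / y) = 1.
  by rewrite innerM innerV xy mulgV.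
by rewrite aut1E /commute => {2}<- /=; rewrite mulgVK.
Qed.

Lemma inner_Gamma (G : groupType) (H : groupClosed (Out G)) (g : G) :
  inner g \in Gamma H.
Proof.
rewrite inE (_ : Psi _ = 1) ?gpred1 //.
by apply/Psi_eqP/InnP; exists g; rewrite divg1.
Qed.

Theorem proposition2p5 (G : groupType) (H : groupClosed (Out G)) (phi : Aut G) :
  finitely_generated G ->
  trivial_center G ->
  (exists x : G, forall h : Aut G, h \in Gamma H -> phi x <> h x) ->
  conjugacy_separable (Gamma_group H) ->
  exists (F : finGroupType) (q : {multiplicative Out G -> F}),
    ~ exists2 h : Out G, h \in H & q (Psi phi) = q h.
Proof.
move=> fgG ZG [x phix] csH.
pose inn g : Gamma_group H := MkGamma (inner_Gamma H g).
have innM : {morph inn : g h / g * h}.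
  by move=> g h; apply/val_inj; rewrite valM /= innerM.
have innJ (k : Gamma_group H) g : k * inn g * k^-1 = inn (val k g).
  by apply/val_inj; rewrite !valM (homV k (@valM _ _ _)) /= innerJ.
have nconj : ~ Defs.conjugate (inn x) (inn (phi x)).
  (* A conjugator [k] gives [inner (phi x) = inner (k^-1 x)], hence [phi x = k^-1 x] with [k^-1] in
     [Gamma H]. *)
  move=> [k kE]; apply: (phix (val k^-1)); first exact: valP.
  apply: (inner_inj ZG); move/(congr1 val): kE.
  by rewrite conjgE mulgA -{2}[k]invgK innJ.
have [F [f [_ nconjf]]] := csH _ _ nconj.
have [e eP] := finite_homs F fgG.
have [|th thE] := @aut_perm_rep G F e.
  by move=> u a /eP uM; apply/eP/is_hom_comp.
have [F' [q qP]] := out_hom_of_aut_hom th.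
exists F', q => -[h hH]; rewrite -(PsiK h) => /qP[g phi_h].
have rhoe : f \o inn \in e by apply/eP => y z; rewrite /= innM gmulfM.
have hG : repr h \in Gamma H by rewrite inE PsiK.
apply: nconjf.
(* Both permutations are evaluated at the point [f \o inn], and the resulting homomorphisms at
   [x]. *)
have := congr1 (fun p : {perm _} => val (p (SeqSub rhoe)) x) phi_h.
rewrite !thE /= => ->.
pose k : Gamma_group H := inn g * MkGamma hG.
(* The inverse appears because [y ^ z] is [z^-1 * y * z], while [innJ] conjugates by [k] on the
   left. *)
exists (f k)^-1.
by rewrite conjgE invgK mulgA -(homV k (gmulfM (s := f))) -!gmulfM innJ.
Qed.
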